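(* Let $A$ be a Banach algebra, let $B$ be a Banach $A$-bimodule, let $n\ge 0$ be an even integer, and let $b_0^{(n+1)}\in B^{(n+1)}$. Then $b_0^{(n+1)}\in wap_\ell(B^{(n)})$ if and only if the mapping $T:b^{(n+2)}\mapsto b^{(n+2)}b_0^{(n+1)}$ from $B^{(n+2)}$ into $A^{(n+1)}$ is weak$^*$-to-weak continuous.
   Context: For a Banach space $X$ put $X^{(0)}=X$ and $X^{(k+1)}=(X^{(k)})^*$; $X^{(k)}$ is identified with its canonical image in $X^{(k+2)}$. For a bounded bilinear map $m:X\times Y\to Z$ of normed spaces define $m^*:Z^*\times X\to Y^*$ by $\langle m^*(z',x),y\rangle=\langle z',m(x,y)\rangle$, $m^{**}=(m^* )^*:Y^{**}\times Z^*\to X^*$ and $m^{***}=(m^{**})^*:X^{**}\times Y^{**}\to Z^{**}$. For every even $k\ge 0$, $A^{(k)}$ is a Banach algebra and $B^{(k)}$ is a Banach $A^{(k)}$-bimodule, defined recursively from the given (bounded) multiplication and module actions: the multiplication (first Arens product) and the two module actions at level $k+2$ are the extensions $m^{***}$ of those at level $k$. Products are written by juxtaposition. Explicitly, for $k$ even, $a\in A^{(k)}$, $b\in B^{(k)}$, $b'\in B^{(k+1)}$, $b''\in B^{(k+2)}$: $b'a\in B^{(k+1)}$ with $\langle b'a,b\rangle=\langle b',ab\rangle$; $b''b'\in A^{(k+1)}$ with $\langle b''b',a\rangle=\langle b'',b'a\rangle$. $wap_\ell(B^{(n)})$ is the closed subspace of $B^{(n+1)}$ consisting of all weakly left almost periodic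 functionals, i.e. those $b^{(n+1)}\in B^{(n+1)}$ for which the set $\{b^{(n+1)}a^{(n)}: a^{(n)}\in A^{(n)},\ \|a^{(n)}\|\le 1\}$ is relatively weakly compact in $B^{(n+1)}$. Weak$^*$-to-weak continuity of $T$ is with respect to $\sigma(B^{(n+2)},B^{(n+1)})$ on $B^{(n+2)}$ and $\sigma(A^{(n+1)},A^{(n+2)})$ on $A^{(n+1)}$. *)

(* Defs.v *)
From HB Require Import structures.
From mathcomp Require Import all_boot all_order all_algebra.
From mathcomp Require Import complex.
From mathcomp Require Import all_classical all_reals all_analysis.

Set Implicit Arguments.
Unset Strict Implicit.
Unset Printing Implicit Defensive.

Import Order.TTheory GRing.Theory Num.Theory.
Import numFieldNormedType.Exports.

Local Open Scope classical_set_scope.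
Local Open Scope ring_scope.

Variant scalar_kind := real_scalars | complex_scalars.

(* The scalar field of the Banach spaces: the real numbers R or the complex
   numbers R[i]. *)
Definition scalar_field (R : realType) (s : scalar_kind) : numFieldType :=
  match s with real_scalars => R | complex_scalars => R[i] end.

Definition scalar_re (R : realType) (s : scalar_kind) : scalar_field R s -> R :=
  match s with
  | real_scalars => fun x => x
  | complex_scalars => fun z => complex.Re z
  end.

Definition scalar_of (R : realType) (s : scalar_kind) : R -> scalar_field R s :=
  match s with
  | real_scalars => fun x => x
  | complex_scalars => fun x => x%:C%C
  end.

Section scalar_theory.
Variables (R : realType) (s : scalar_kind).
Implicit Types x y : scalar_field R s.

Lemma scalar_ofK : cancel (@scalar_of R s) (@scalar_re R s).
Proof. by case: s. Qed.

Lemma scalar_reK x : 0 <= x -> scalar_of s (scalar_re x) = x.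
Proof.
case: s x => //= -[a b]; rewrite lecE /= => /andP[/eqP -> _].
by [].
Qed.

Lemma scalar_re_le x y : x <= y -> scalar_re x <= scalar_re y.
Proof. by case: s x y => //= -[a b] [c d]; rewrite lecE /= => /andP[]. Qed.

Lemma scalar_of_le (a b : R) : (scalar_of s a <= scalar_of s b) = (a <= b).
Proof. by case: s => //=; rewrite lecR. Qed.

End scalar_theory.

Section dual_space.
Variables (R : realType) (s : scalar_kind).
Local Notation K := (scalar_field R s).
Variable X : normedModType K.

Definition dual_pred : {pred X -> K^o} :=
  fun f => `[< linear f /\ continuous f >].

Lemma dual_pred_submod_closed : submod_closed dual_pred.
Proof.
split=> [|a f g /asboolP[lf cf] /asboolP[lg cg]]; apply/asboolP; split.
- by move=> a x y; rewrite -[LHS]/0 -[RHS]/(a *: 0 + 0) scaler0 addr0.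
- exact: cst_continuous.
- move=> b x y; rewrite -[LHS]/(a *: f (b *: x + y) + g (b *: x + y)).
  rewrite -[RHS]/(b *: (a *: f x + g x) + (a *: f y + g y)).
  rewrite lf lg !scalerDr !scalerA (mulrC a b) -!scalerA.
  by rewrite addrACA.
- by move=> x; apply: cvgD; [apply: cvgZr; exact: cf|exact: cg].
Qed.

HB.instance Definition _ :=
  GRing.isSubmodClosed.Build K (X -> K^o) dual_pred dual_pred_submod_closed.

Record dual := Dual { dual_val :> X -> K^o; _ : dual_val \in dual_pred }.

HB.instance Definition _ := [isSub for dual_val].
HB.instance Definition _ := [Choice of dual by <:].
HB.instance Definition _ := [SubChoice_isSubLmodule of dual by <:].

Implicit Types f g : dual.

Lemma dual_linear f : linear f.
Proof. by case: f => f /= /asboolP[]. Qed.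

Lemma dual_continuous f : continuous f.
Proof. by case: f => f /= /asboolP[]. Qed.

HB.instance Definition _ f :=
  GRing.isLinear.Build K X K^o *:%R f (dual_linear f).

Definition dual_norm f : K :=
  scalar_of s (sup [set scalar_re `|f x : K| | x in [set x | `|x| <= 1]]).

Lemma dual_has_sup f :
  has_sup [set scalar_re `|f x : K| | x in [set x | `|x| <= 1]].
Proof.
split; first by exists (scalar_re `|f 0 : K|), 0 => //=; rewrite normr0.
have /linear_bounded_continuous/bounded_funP/(_ 1)[M fM] :
  continuous (f : {linear X -> K^o}) by exact: dual_continuous.
exists (scalar_re M) => _ [x /= x1 <-]; apply: scalar_re_le; exact: fM.
Qed.

Lemma dual_norm_ub f x : `|x| <= 1 -> `|f x : K| <= dual_norm f.
Proof.
move=> x1; rewrite -[leLHS]scalar_reK// scalar_of_le.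
by apply: ub_le_sup; [exact: (dual_has_sup f).2|exists x].
Qed.

Lemma dual_norm_le f (M : K) :
  (forall x, `|x| <= 1 -> `|f x : K| <= M) -> dual_norm f <= M.
Proof.
move=> fM; have M0 : 0 <= M.
  by apply: le_trans (fM 0 _) => //; rewrite normr0.
rewrite -[leRHS]scalar_reK// scalar_of_le.
apply: ge_sup; first exact: (dual_has_sup f).1.
by move=> _ [x x1 <-]; apply: scalar_re_le; exact: fM.
Qed.

Lemma dual_norm_ge0 f : 0 <= dual_norm f.
Proof.
by apply: le_trans (dual_norm_ub f (x := 0) _) => //; rewrite normr0.
Qed.

Lemma ler_dual_norm f x : `|f x : K| <= dual_norm f * `|x|.
Proof.
have [->|x0] := eqVneq x 0; first by rewrite linear0 !normr0 mulr0.
have nx : 0 < `|x| by rewrite normr_gt0.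
rewrite -ler_pdivrMr// mulrC.
have := @dual_norm_ub f (`|x|^-1 *: x).
by rewrite linearZ /= !normrZ normfV normr_id mulVf ?gt_eqF//; apply.
Qed.

Lemma dual_normD f g : dual_norm (f + g) <= dual_norm f + dual_norm g.
Proof.
apply: dual_norm_le => x x1; apply: le_trans (ler_normD _ _) _.
by apply: lerD; exact: dual_norm_ub.
Qed.

Lemma dual_normZ (a : K) f : dual_norm (a *: f) = `|a| * dual_norm f.
Proof.
apply/eqP; rewrite eq_le; apply/andP; split.
  apply: dual_norm_le => x x1; rewrite [X in `|X|]/(a * f x) normrM.
  by rewrite ler_wpM2l// dual_norm_ub.
have [->|a0] := eqVneq a 0; first by rewrite normr0 mul0r dual_norm_ge0.
rewrite -ler_pdivlMl ?normr_gt0//; apply: dual_norm_le => x x1.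
rewrite ler_pdivlMl ?normr_gt0// -normrM.
exact: (@dual_norm_ub (a *: f)).
Qed.

Lemma dual_norm0_eq0 f : dual_norm f = 0 -> f = 0.
Proof.
move=> f0; apply/val_inj/funext => x; apply/eqP; rewrite -normr_le0.
by have := ler_dual_norm f x; rewrite f0 mul0r.
Qed.

HB.instance Definition _ :=
  Lmodule_isNormed.Build K dual dual_normD dual_normZ dual_norm0_eq0.

End dual_space.

Fixpoint iterdual (R : realType) (s : scalar_kind)
    (X : normedModType (scalar_field R s)) (n : nat) :
    normedModType (scalar_field R s) :=
  if n is n'.+1 then dual (iterdual X n') else X.

Record bounded_bilinear (K : numFieldType) (X Y Z : normedModType K) :=
  BoundedBilinear {
    bb_map :> {bilinear X -> Y -> Z};
    bb_bounded : exists M : K, forall x y, `|bb_map x y| <= M * `|x| * `|y|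
  }.

Lemma bb_bounded_norm (K : numFieldType) (X Y Z : normedModType K)
    (m : bounded_bilinear X Y Z) :
  exists2 M : K, 0 <= M & forall x y, `|m x y| <= M * `|x| * `|y|.
Proof.
have [M mM] := bb_bounded m; exists `|M| => // x y.
have M0 : 0 <= M * `|x| * `|y| by exact: le_trans (normr_ge0 _) (mM x y).
apply: le_trans (mM x y) _.
by rewrite -[leLHS](ger0_norm M0) !normrM !normr_id.
Qed.

Section adjoint.
Variables (R : realType) (s : scalar_kind).
Local Notation K := (scalar_field R s).
Variables (X Y Z : normedModType K) (m : bounded_bilinear X Y Z).

Lemma adjoint_linear (z' : dual Z) (x : X) :
  linear (fun y : Y => z' (m x y) : K^o).
Proof. by move=> a u v; rewrite /= linearPr linearP. Qed.

Lemma adjoint_continuous (z' : dual Z) (x : X) :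
  continuous (fun y : Y => z' (m x y) : K^o).
Proof.
pose f : {linear Y -> K^o} := HB.pack (fun y => z' (m x y) : K^o)
  (GRing.isLinear.Build K Y K^o *:%R _ (adjoint_linear z' x)).
have [M M0 mM] := bb_bounded_norm m.
apply: (@bounded_linear_continuous _ _ _ f); apply/bounded_funP => r.
exists (`|z'| * (M * `|x| * r)) => y yr.
apply: le_trans (ler_dual_norm _ _) _.
apply: ler_wpM2l; first exact: dual_norm_ge0.
by apply: le_trans (mM _ _) _; rewrite ler_wpM2l// mulr_ge0.
Qed.

Lemma adjoint_subproof (z' : dual Z) (x : X) :
  (fun y : Y => z' (m x y) : K^o) \in @dual_pred R s Y.
Proof.
by apply/asboolP; split; [exact: adjoint_linear|exact: adjoint_continuous].
Qed.

Definition adjoint_map (z' : dual Z) (x : X) : dual Y :=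
  Dual (adjoint_subproof z' x).

Lemma adjoint_bilinear : bilinear_for *:%R *:%R adjoint_map.
Proof.
split=> [x|z'] a u v; apply/val_inj/funext => y //=.
by rewrite linearPl linearP.
Qed.

HB.instance Definition _ :=
  bilinear_isBilinear.Build K (dual Z) X (dual Y) *:%R *:%R adjoint_map
    adjoint_bilinear.

Lemma adjoint_bounded :
  exists M : K, forall z' x, `|adjoint_map z' x| <= M * `|z'| * `|x|.
Proof.
have [M M0 mM] := bb_bounded_norm m.
exists M => z' x; apply: dual_norm_le => y y1 /=.
apply: le_trans (ler_dual_norm _ _) _; rewrite (mulrC M) -!mulrA.
apply: ler_wpM2l; first exact: dual_norm_ge0.
apply: le_trans (mM _ _) _; rewrite -mulrA ler_wpM2l// ler_piMr//.
Qed.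

Definition adjoint : bounded_bilinear (dual Z) X (dual Y) :=
  BoundedBilinear adjoint_bounded.

End adjoint.

Definition arens_extension (R : realType) (s : scalar_kind)
    (X Y Z : normedModType (scalar_field R s)) (m : bounded_bilinear X Y Z) :
    bounded_bilinear (dual (dual X)) (dual (dual Y)) (dual (dual Z)) :=
  adjoint (adjoint (adjoint m)).

Lemma evenSS (n : nat) : ~~ odd n.+2 -> ~~ odd n.
Proof. by rewrite /= negbK. Qed.

(* The extension of m to the n-th duals, for n even. *)
Fixpoint iter_arens (R : realType) (s : scalar_kind)
    (X Y Z : normedModType (scalar_field R s)) (m : bounded_bilinear X Y Z)
    (n : nat) :
    ~~ odd n ->
    bounded_bilinear (iterdual X n) (iterdual Y n) (iterdual Z n) :=
  match n with
  | 0 => fun=> m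
  | 1 => fun odd1 => False_rect _ (notF odd1)
  | n'.+2 => fun even_n => arens_extension (iter_arens m (evenSS even_n))
  end.

Record banach_algebra (R : realType) (s : scalar_kind) := BanachAlgebra {
  ba_space :> completeNormedModType (scalar_field R s);
  ba_mul : bounded_bilinear ba_space ba_space ba_space;
  ba_mulA : associative ba_mul;
  ba_normM : forall a b, `|ba_mul a b| <= `|a| * `|b|
}.

Record banach_bimodule (R : realType) (s : scalar_kind)
    (A : banach_algebra R s) := BanachBimodule {
  bm_space :> completeNormedModType (scalar_field R s);
  bm_lact : bounded_bilinear A bm_space bm_space;
  bm_ract : bounded_bilinear bm_space A bm_space;
  bm_lactA : forall a1 a2 b,
    bm_lact (ba_mul A a1 a2) b = bm_lact a1 (bm_lact a2 b);
  bm_ractA : forall b a1 a2,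
    bm_ract b (ba_mul A a1 a2) = bm_ract (bm_ract b a1) a2;
  bm_lractA : forall a1 b a2,
    bm_ract (bm_lact a1 b) a2 = bm_lact a1 (bm_ract b a2)
}.

(* sigma(X, X^* ): the coarsest topology on X making every functional in X^*
   continuous, i.e. the one induced by pointwise convergence on X^*. *)
Definition weak (R : realType) (s : scalar_kind)
    (X : normedModType (scalar_field R s)) : topologicalType :=
  initial_topology
    (fun x : X => (fun f => f x) : {ptws dual X -> (scalar_field R s)^o}).

(* sigma(X^*, X) *)
Definition weak_star (R : realType) (s : scalar_kind)
    (X : normedModType (scalar_field R s)) : topologicalType :=
  initial_topology
    (fun f : dual X => (fun x => f x) : {ptws X -> (scalar_field R s)^o}).

Section module_operations.
Variables (R : realType) (s : scalar_kind).
Variables (A : banach_algebra R s) (B : banach_bimodule A).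
Variables (n : nat) (even_n : ~~ odd n).

(* The module action A^(n) x B^(n) -> B^(n). *)
Definition lact_at :
    bounded_bilinear (iterdual A n) (iterdual B n) (iterdual B n) :=
  iter_arens (bm_lact B) even_n.

(* b' a in B^(n+1), with <b' a, b> = <b', a b>. *)
Definition dual_act :
    bounded_bilinear (iterdual B n.+1) (iterdual A n) (iterdual B n.+1) :=
  adjoint lact_at.

(* b'' b' in A^(n+1), with <b'' b', a> = <b'', b' a>. *)
Definition bidual_act :
    bounded_bilinear (iterdual B n.+2) (iterdual B n.+1) (iterdual A n.+1) :=
  adjoint dual_act.

Definition wap_left : set (iterdual B n.+1) :=
  [set b' | precompact
    ([set dual_act b' a | a in [set a : iterdual A n | `|a| <= 1]]
       : set (weak (iterdual B n.+1)))].

End module_operations.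

Arguments lact_at {R s A} B {n} even_n.
Arguments dual_act {R s A} B {n} even_n.
Arguments bidual_act {R s A} B {n} even_n.
Arguments wap_left {R s A} B {n} even_n _.

(* Main.v *)
Require Import Defs.
From HB Require Import structures.
From mathcomp Require Import all_boot all_order all_algebra.
From mathcomp Require Import complex.
From mathcomp Require Import all_classical all_reals all_analysis.
From mathcomp Require Import ring lra.

(** Let S be the bounded operator sending a to b0 a, from A^(n) to B^(n+1).
  By definition of the products, <b'' b0, a> = <b'', S a>, so T is the adjoint
  of S; and b0 is weakly left almost periodic exactly when S maps the unit ball
  to a relatively weakly compact set. The theorem is therefore Gantmacher's
  theorem for S : X -> Y, proved below for arbitrary normed spaces: S is weakly
  compact iff its adjoint T : Y^* -> X^* is weak*-to-weak continuous.

  Both properties are equivalent to a third: for every x'' in X^** the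
  functional x'' o T on Y^* is the evaluation at a point y of Y, that is, the
  second adjoint of S maps X^** into Y.

  - If T is weak*-to-weak continuous, then each x'' o T is weak*-continuous,
    hence an evaluation ([weak_star_functional]). The set of the points y that
    arise from the x'' of norm at most 1 contains the image of the unit ball
    of X, and it is weakly compact and weakly closed because the unit ball of
    X^** is weak*-compact ([banach_alaoglu]).

  - If S is weakly compact and x'' has norm at most 1, then x'' is the weak*
    limit of a filter on the unit ball of X ([goldstine]). The image of this
    filter under S has a weak cluster point y, and y represents x'' o T. So
    x'' o T is weak*-continuous for all x'', which is the continuity of T.

  Goldstine's theorem is a minimization: a point x of the ball which almost
  minimizes the sum of the squares of the differences f x - x'' f, for f in a
  finite set of functionals (of their real parts, in fact), makes this sum small
  ([goldstine_sum_squares]). *)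

Set Implicit Arguments.
Unset Strict Implicit.
Unset Printing Implicit Defensive.

Import Order.TTheory GRing.Theory Num.Theory.
Import numFieldNormedType.Exports.

Local Open Scope classical_set_scope.
Local Open Scope ring_scope.

(** * Convergence in the weak and weak* topologies *)

Lemma initial_cvgP (S : choiceType) (T : topologicalType) (f : S -> T)
    (F : set_system S) (x : S) : Filter F ->
  F --> (x : initial_topology f) <-> f @ F --> f x.
Proof.
move=> FF; split=> [Fx|fFx].
  by apply: cvg_trans (@initial_continuous S T f x); apply: cvg_app.
move=> A [_ [[C Cop <-] Cfx CA]].
apply: (filterS CA); apply: fFx; exact: open_nbhs_nbhs.
Qed.

Section weak_topologies.
Variables (R : realType) (s : scalar_kind).
Local Notation K := (scalar_field R s).
Variable X : normedModType K.

Lemma weak_cvgP (F : set_system X) (x : X) : Filter F ->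
  F --> (x : weak X) <-> forall f : dual X, f @ F --> (f x : K^o).
Proof.
move=> FF; rewrite initial_cvgP.
exact: (@pointwise_cvgP (dual X) K^o).
Qed.

Lemma weak_star_cvgP (F : set_system (dual X)) (f : dual X) : Filter F ->
  F --> (f : weak_star X) <->
  forall x, (g x : K^o) @[g --> F] --> (f x : K^o).
Proof.
move=> FF; rewrite initial_cvgP.
exact: (@pointwise_cvgP X K^o).
Qed.

End weak_topologies.

(** * Real parts and ultrafilter limits of scalars *)

Section scalars.
Variables (R : realType) (s : scalar_kind).
Local Notation K := (scalar_field R s).
Implicit Types x y : K.

Lemma scalar_re_is_zmod_morphism : zmod_morphism (@scalar_re R s).
Proof. by case: s => //= -[a b] [c d]. Qed.
HB.instance Definition _ := GRing.isZmodMorphism.Build K R (@scalar_re R s)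
  scalar_re_is_zmod_morphism.

Lemma scalar_of_is_zmod_morphism : zmod_morphism (@scalar_of R s).
Proof. by case: s => //= a b; rewrite rmorphB. Qed.
HB.instance Definition _ := GRing.isZmodMorphism.Build R K (@scalar_of R s)
  scalar_of_is_zmod_morphism.

Lemma scalar_re_ofM (a : R) x : scalar_re (scalar_of s a * x) = a * scalar_re x.
Proof. by case: s x => //= -[b c] /=; rewrite mul0r subr0. Qed.

Lemma scalar_reZ (a : R) (x : K^o) :
  scalar_re (scalar_of s a *: x : K) = a * scalar_re (x : K).
Proof. exact: scalar_re_ofM. Qed.

Lemma scalar_of_ge0 (a : R) : (0 <= scalar_of s a) = (0 <= a).
Proof. by rewrite -(raddf0 (@scalar_of R s)) scalar_of_le. Qed.

Lemma scalar_re_ge0 x : 0 <= x -> 0 <= scalar_re x.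
Proof. by move=> /scalar_re_le; rewrite raddf0. Qed.

Lemma scalar_of1 : scalar_of s 1 = 1 :> K.
Proof. by case: s. Qed.

Lemma norm_scalar_of (a : R) : `|scalar_of s a| = scalar_of s `|a|.
Proof.
have [a0|a0] := leP 0 a; first by rewrite !ger0_norm// scalar_of_ge0.
have a0' : 0 <= - a by lra.
by rewrite (ler0_norm (ltW a0)) -normrN -raddfN ger0_norm// scalar_of_ge0.
Qed.

Lemma norm_scalar_re x : `|scalar_re x| <= scalar_re `|x|.
Proof.
case: s x => //= x; have := normc_ge_Re x.
by rewrite /= -[X in X <= _]/(_%:C%C) lecR.
Qed.

(** A scalar is recovered from two real parts, which allows the real and the
  complex case to be treated at once: over the complex numbers
  x = Re x + i Re (- i x), and over the real numbers c = 0 does. *)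
Lemma scalar_decomposition : exists c d : K,
  forall x, x = scalar_of s (scalar_re x) + c * scalar_of s (scalar_re (d * x)).
Proof.
case: s; first by exists 0, 0 => x; rewrite mul0r addr0.
exists 'i%C, (- 'i%C) => -[a b] /=.
by apply/eqP; rewrite eq_complex /=; apply/andP; split; apply/eqP; ring.
Qed.

Lemma scalar_of_continuous : continuous (@scalar_of R s : R -> K^o).
Proof.
move=> a; apply/cvgrPdist_le => /= e e0.
have re0 : 0 < scalar_re e.
  rewrite ltNge; apply/negP => re_le0; have : e <= 0.
    have := scalar_of_le s (scalar_re e) 0.
    by rewrite raddf0 scalar_reK ?re_le0// ltW.
  by rewrite lt_geF.
near=> b.
have ab : `|a - b| <= scalar_re e by near: b; exact: cvgr_dist_le.
by move: ab; rewrite -(scalar_of_le s) -norm_scalar_of raddfB scalar_reK// ltW.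
Unshelve. all: by end_near. Qed.

(** Convergence of scalars follows from that of the two real parts. The limit is
  built from arbitrary real limits a and b, so that its existence is obtained
  too; the decomposition is repeated because it must hold with the same c and d
  when the limit is known beforehand. *)
Lemma cvg_scalar_decomposition : exists c d : K,
  (forall x,
    x = scalar_of s (scalar_re x) + c * scalar_of s (scalar_re (d * x))) /\
  forall (T : Type) (F : set_system T) (h : T -> K) (a b : R), Filter F ->
  scalar_re (h t) @[t --> F] --> a -> scalar_re (d * h t) @[t --> F] --> b ->
  (h t : K^o) @[t --> F] --> (scalar_of s a + c * scalar_of s b : K^o).
Proof.
have [c [d cdE]] := scalar_decomposition; exists c, d; split=> //.
move=> T F h a b FF ha hb.
rewrite [h in X in X --> _](funext (fun t => cdE (h t))).
apply: (@cvgD _ K^o).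
  exact: (cvg_comp _ _ ha (@scalar_of_continuous a)).
apply: (@cvgZr _ K^o).
exact: (cvg_comp _ _ hb (@scalar_of_continuous b)).
Qed.

Lemma ultra_cvg_real (T : Type) (F : set_system T) (h : T -> R) (M : R) :
  UltraFilter F -> F [set t | `|h t| <= M] -> exists a : R, h @ F --> a.
Proof.
move=> FU FM.
have : F (h @^-1` `[- M, M]%classic).
  by apply: filterS FM => t /=; rewrite in_itv /= -ler_norml.
move=> /(@segment_compact R (- M) M (h @ F))[a [_ Fa]]; exists a => A Aa.
have [//|FnA] := in_ultra_setVsetC (h @^-1` A) FU.
by have [b []] := Fa (~` A) A FnA Aa.
Qed.

Lemma ultra_cvg_scalar (T : Type) (F : set_system T) (h : T -> K) (M : K) :
  UltraFilter F -> F [set t | `|h t| <= M] ->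
  exists l : K, (h t : K^o) @[t --> F] --> (l : K^o).
Proof.
move=> FU FM; have [c [d [_ hcvg]]] := cvg_scalar_decomposition.
have [|a ha] := @ultra_cvg_real T F (fun t => scalar_re (h t)) (scalar_re M) FU.
  apply: filterS FM => t /= /scalar_re_le; apply: le_trans.
  exact: norm_scalar_re.
have [|b hb] := @ultra_cvg_real T F (fun t => scalar_re (d * h t))
    (scalar_re (`|d| * M)) FU.
  apply: filterS FM => t /= hM; apply: le_trans (norm_scalar_re _) _.
  by rewrite scalar_re_le// normrM ler_wpM2l.
by exists (scalar_of s a + c * scalar_of s b); exact: hcvg.
Qed.

End scalars.

(** * The unit ball of a dual space is weak*-compact *)

Section functionals.
Variables (R : realType) (s : scalar_kind).
Local Notation K := (scalar_field R s).

Lemma dual_of_bounded (X : normedModType K) (g : X -> K^o) (M : K) : linear g ->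
  (forall x, `|g x : K| <= M * `|x|) -> exists f : dual X, f =1 g.
Proof.
move=> lg gM.
pose h : {linear X -> K^o} := HB.pack g
  (GRing.isLinear.Build K X K^o *:%R _ lg).
have ch : continuous h.
  apply/linear_bounded_continuous/bounded_funP => r; exists (`|M| * r) => x xr.
  apply: le_trans (gM x) _; apply: le_trans (_ : `|M * `|x| | <= _).
    by rewrite real_ler_norm// ger0_real// (le_trans _ (gM x)).
  by rewrite normrM normr_id ler_wpM2l.
have gd : g \in @dual_pred R s X by apply/asboolP; split.
by exists (Dual gd).
Qed.

Lemma bidual_eval (X : normedModType K) (x : X) : exists2 x'' : dual (dual X),
  `|x''| <= `|x| & forall f : dual X, x'' f = f x.
Proof.
have lx : linear (fun f : dual X => f x : K^o) by [].
have [f|x'' x''E] := @dual_of_bounded (dual X) _ `|x| lx.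
  by rewrite mulrC; exact: ler_dual_norm.
exists x'' => //; apply: dual_norm_le => f f1; rewrite x''E.
by apply: le_trans (ler_dual_norm f x) _; rewrite ler_piMl.
Qed.

(** The pointwise limit along an ultrafilter exists because scalars in a disc
  are compact, and it inherits linearity and the bound. Functionals are indexed
  by an arbitrary type so that the ultrafilter may live elsewhere, such as on
  a set of points represented by functionals. *)
Lemma banach_alaoglu (X : normedModType K) (T : Type) (F : set_system T)
    (p : T -> dual X) (M : K) :
  UltraFilter F -> F [set t | `|p t| <= M] ->
  exists2 f : dual X, `|f| <= M &
    forall x, (p t x : K^o) @[t --> F] --> (f x : K^o).
Proof.
move=> FU FM.
have M0 : 0 <= M by have [t] := filter_ex FM; apply: le_trans.
have pM x : F [set t | `|p t x : K| <= M * `|x|].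
  apply: filterS FM => t /= pM; apply: le_trans (ler_dual_norm _ _) _.
  by rewrite ler_wpM2r.
have /choice[g gp] : forall x, exists l : K,
    (p t x : K^o) @[t --> F] --> (l : K^o).
  by move=> x; exact: (ultra_cvg_scalar FU (pM x)).
have g_lim x (l : K) : (p t x : K^o) @[t --> F] --> (l : K^o) -> l = g x.
  by move=> pl; apply: (cvg_unique _ pl (gp x)).
have gM x : `|g x| <= M * `|x|.
  apply/ler_addgt0Pr => e e0.
  have /cvgrPdist_le/(_ e e0) gpe := gp x.
  have [t [/= pt gt]] := filter_ex (filterI (pM x) gpe).
  rewrite -[g x](subrK (p t x)) addrC; apply: le_trans (ler_normD _ _) _.
  exact: lerD.
have lg : linear (g : X -> K^o).
  move=> a x y; apply/esym/g_lim.
  rewrite [X in X @ _](_ : _ = fun t => a *: (p t x : K^o) + p t y); last first.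
    by apply/funext => t; rewrite linearP.
  by apply: cvgD; [apply: cvgZr|]; exact: gp.
have [f fg] := dual_of_bounded lg gM.
exists f => [|x]; last by rewrite fg; exact: gp.
apply: dual_norm_le => x x1; rewrite fg; apply: le_trans (gM x) _.
by rewrite ler_piMr.
Qed.

End functionals.

(** * Weak*-continuous functionals are evaluations *)

Section weak_star_functional.
Variables (R : realType) (s : scalar_kind).
Local Notation K := (scalar_field R s).
Variable Y : normedModType K.

(** This is the linear algebra fact that phi is in the span of finitely many
  functionals when it vanishes on their common kernel; the functionals are
  evaluations here, and a combination of evaluations is an evaluation. *)
Lemma functional_vanishing_on_kernels (L : seq Y) (phi : dual Y -> K^o) :
  linear phi ->
  (forall f : dual Y, (forall y, y \in L -> f y = 0) -> phi f = 0) ->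
  exists y, forall f : dual Y, phi f = f y.
Proof.
elim: L phi => [|y0 L IH] phi lphi phi0.
  by exists 0 => f; rewrite linear0 phi0.
pose phiL : {linear dual Y -> K^o} := HB.pack phi
  (GRing.isLinear.Build K (dual Y) K^o *:%R _ lphi).
(* If some f0 is killed by L but not by y0, subtracting a multiple of the
   evaluation at y0 makes phi vanish at f0; otherwise y0 is redundant. *)
have [[f0 f0L f0y0]|nf0] := pselect (exists2 f0 : dual Y,
    forall y, y \in L -> f0 y = 0 & f0 y0 != 0); last first.
  apply: (IH phi lphi) => f fL; apply: phi0 => y.
  rewrite inE => /predU1P[->|/fL//].
  by apply/eqP/negP => /negP fy0; apply: nf0; exists f.
pose c : K := phi f0 / f0 y0.
have [] := IH (fun f => phi f - c * f y0).
- move=> a f g; rewrite lphi.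
  rewrite -[(a *: f + g) y0]/((a : K) * f y0 + g y0 : K).
  rewrite -[a *: phi f]/(a * phi f).
  rewrite -[RHS]/(a * (phi f - c * f y0) + (phi g - c * g y0)).
  ring.
- move=> f fL; apply/eqP; rewrite subr_eq0; apply/eqP.
  have /eqP : phi (f - (f y0 / f0 y0 : K) *: f0) = 0.
    apply: phi0 => y; rewrite -[LHS]/((f y : K) - (f y0 / f0 y0) * f0 y).
    rewrite inE => /predU1P[->|yL]; first by rewrite divfK// subrr.
    have -> : f y = 0 :> K := fL y yL.
    have -> : f0 y = 0 :> K := f0L y yL.
    by rewrite mulr0 subrr.
  rewrite -[phi]/(phiL : _ -> _) linearB linearZ subr_eq0 => /eqP ->.
  by rewrite /c /= -[LHS]/(_ / _ * phi f0) mulrAC -mulrA mulrC.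
move=> y1 y1E; exists (y1 + c *: y0) => f.
by rewrite linearD linearZ /= -y1E subrK.
Qed.

(** The annihilators of the finite subsets of Y form a filter base converging to
  0 in the weak* topology, so phi is bounded by 1 on one of them. This is a
  linear subspace, so phi vanishes on it. *)
Lemma weak_star_functional (phi : dual Y -> K^o) :
  linear phi -> continuous (phi : weak_star Y -> K^o) ->
  exists y, forall f : dual Y, phi f = f y.
Proof.
move=> lphi cphi.
pose phiL : {linear dual Y -> K^o} := HB.pack phi
  (GRing.isLinear.Build K (dual Y) K^o *:%R _ lphi).
pose B (L : seq Y) := [set f : dual Y | forall y, y \in L -> f y = 0].
have FB : ProperFilter (filter_from setT B).
  apply: filter_from_proper; last first.
    by move=> L _; exists 0.
  apply: filter_from_filter; first by exists [::].
  move=> L1 L2 _ _; exists (L1 ++ L2) => // f fL.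
  by split=> y yL; apply: fL; rewrite mem_cat yL ?orbT.
have F0 : filter_from setT B --> (0 : weak_star Y).
  apply/weak_star_cvgP => y; apply: cvg_near_cst.
  by exists [:: y] => // f; apply; rewrite mem_head.
have /cvgrPdist_lt/(_ 1 ltr01)[L _ Lphi] :
    phi @ filter_from setT B --> (phi 0 : K^o).
  by move=> A /(cphi 0)/F0.
apply: (@functional_vanishing_on_kernels L) => // f fL.
apply/eqP/negPn/negP => phif0.
have : B L ((phi f)^-1 *: f).
  move=> y yL; rewrite -[LHS]/((phi f : K)^-1 * f y).
  by have -> : f y = 0 :> K := fL y yL; rewrite mulr0.
move=> /Lphi /=; rewrite -[phi]/(phiL : _ -> _) linear0 linearZ sub0r normrN.
by rewrite /= [_ *: _]mulVf// normr1 ltxx.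
Qed.

End weak_star_functional.

(** * Goldstine's theorem *)

Section goldstine.
Variables (R : realType) (s : scalar_kind).
Local Notation K := (scalar_field R s).
Variable X : normedModType K.

(** Rotating x by a scalar of modulus at most 1 turns the value of f at x into
  minus its modulus. *)
Lemma dual_norm_le_re (f : dual X) (r : R) :
  (forall x, `|x| <= 1 -> - r <= scalar_re (f x)) -> `|f| <= scalar_of s r.
Proof.
move=> fr; apply: dual_norm_le => x x1.
rewrite -[leLHS]scalar_reK// scalar_of_le.
pose a : K := - `|f x : K| / f x.
have a1 : `|a| <= 1.
  rewrite normrM normrN normr_id normfV.
  have [->|fx0] := eqVneq (f x : K) 0; first by rewrite normr0 mul0r.
  by rewrite mulfV// normr_eq0.
have := fr (a *: x); rewrite normrZ mulr_ile1// => /(_ isT).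
rewrite linearZ /= -[a *: (f x : K^o)]/(a * f x : K).
suff -> : a * f x = - `|f x : K| by rewrite raddfN lerN2.
rewrite /a; have [->|fx0] := eqVneq (f x : K) 0.
  by rewrite mulr0 normr0 oppr0.
by rewrite divfK.
Qed.

(** Let phi z be the sum of squares at z, and let x almost minimize phi on the
  ball. Moving from x towards a point z of the ball cannot decrease phi much,
  which bounds below the derivative of phi at x in the direction z - x. With v
  the vector of the differences at x and g the combination of the functionals of
  L with coefficients v, this bound says that Re g z >= Re g x - e for all z in
  the ball, so that |g| <= e - Re g x. As |x''| <= 1, this bounds - Re (x'' g),
  and phi x = Re g x - Re (x'' g) <= e. *)
Lemma goldstine_sum_squares (x'' : dual (dual X)) (L : seq (dual X)) (e : R) :
  `|x''| <= 1 -> 0 < e ->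
  exists2 x : X, `|x| <= 1 &
    \sum_(f <- L) (scalar_re (f x) - scalar_re (x'' f)) ^+ 2 <= e.
Proof.
move=> x''1 e0.
pose t f := scalar_re (x'' f).
pose phi z := \sum_(f <- L) (scalar_re (f z) - t f) ^+ 2.
pose S := [set phi z | z in [set z : X | `|z| <= 1]].
have infS : has_inf S.
  split; first by exists (phi 0), 0 => //=; rewrite normr0.
  by exists 0 => _ [z _ <-]; apply: sumr_ge0 => f _; exact: sqr_ge0.
pose M := \sum_(f <- L) (scalar_re `|f| * 2) ^+ 2.
have M0 : 0 <= M by apply: sumr_ge0 => f _; exact: sqr_ge0.
(* M bounds the quadratic term of phi along any segment in the ball. The step
   lam and the tolerance lam * e below are such that both error terms, lam * M
   and the tolerance divided by lam, are at most e. *)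
pose lam := e / (M + e).
have Me0 : 0 < M + e by lra.
have lam0 : 0 < lam by rewrite divr_gt0.
have lam1 : lam <= 1 by rewrite ler_pdivrMr//; lra.
have lamM : lam * M <= e.
  by rewrite mulrAC ler_pdivrMr// mulrDr lerDl mulr_ge0// ltW.
have [_ [x /= x1 <-] phix] := inf_adherent (mulr_gt0 lam0 e0) infS.
exists x => //.
pose u (f : dual X) z := scalar_re (f z).
pose v f := u f x - t f.
have descent z : `|z| <= 1 ->
    - e <= \sum_(f <- L) v f * (u f z - u f x).
  move=> z1; pose w f := u f z - u f x.
  set p := \sum_(f <- L) _.
  pose q := \sum_(f <- L) w f ^+ 2.
  have qM : q <= M.
    apply: ler_sum => f _; rewrite -real_normK ?num_real// lerXn2r ?nnegrE//.
      by rewrite mulr_ge0// scalar_re_ge0.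
    rewrite /w /u -(raddfB (@scalar_re R s)) -linearB.
    apply: le_trans (norm_scalar_re _) _.
    rewrite mulr_natr -(raddfMn (@scalar_re R s)) scalar_re_le//.
    apply: le_trans (ler_dual_norm _ _) _.
    rewrite -mulr_natr ler_wpM2l ?dual_norm_ge0//.
    by apply: le_trans (ler_normB _ _) _; rewrite -[2]/(1 + 1) lerD.
  pose z' := x + scalar_of s lam *: (z - x).
  have z'1 : `|z'| <= 1.
    have -> : z' = scalar_of s (1 - lam) *: x + scalar_of s lam *: z.
      rewrite /z' (raddfB (@scalar_of R s)) /= scalar_of1.
      by rewrite scalerBl scale1r scalerBr addrA addrAC.
    apply: le_trans (ler_normD _ _) _; rewrite !normrZ.
    have -> : 1 = `|scalar_of s (1 - lam)| + `|scalar_of s lam|.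
      rewrite !norm_scalar_of -(raddfD (@scalar_of R s)) !ger0_norm ?subr_ge0//.
        by rewrite subrK /= scalar_of1.
      exact: ltW.
    by apply: lerD; rewrite ler_piMr.
  have phiz' : phi z' = phi x + 2 * lam * p + lam ^+ 2 * q.
    rewrite /phi /p /q !mulr_sumr -!big_split /=; apply: eq_bigr => f _.
    rewrite /z' linearD linearZ linearB /=.
    rewrite (raddfD (@scalar_re R s)) /= scalar_reZ.
    rewrite (raddfB (@scalar_re R s)) /= /v /w /u.
    ring.
  have infz' : inf S <= phi z' by apply: ge_inf; [exact: infS.2|exists z'].
  nra.
pose g : dual X := \sum_(f <- L) scalar_of s (v f) *: f.
have gE (y'' : dual (dual X)) :
    scalar_re (y'' g) = \sum_(f <- L) v f * scalar_re (y'' f).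
  rewrite linear_sum (raddf_sum (@scalar_re R s)); apply: eq_bigr => f _.
  by rewrite linearZ /= scalar_reZ.
have gzE z : scalar_re (g z) = \sum_(f <- L) v f * u f z.
  have [z'' _ z''E] := bidual_eval z.
  by rewrite -z''E gE; apply: eq_bigr => f _; rewrite z''E.
have g_norm : `|g| <= scalar_of s (e - scalar_re (g x)).
  apply: dual_norm_le_re => z z1; have := descent z z1.
  under eq_bigr do rewrite mulrBr.
  rewrite sumrB -!gzE; lra.
have x''g : - scalar_re (x'' g) <= e - scalar_re (g x).
  apply: le_trans (ler_norm _) _; rewrite normrN.
  apply: le_trans (norm_scalar_re _) _.
  rewrite -[leRHS](@scalar_ofK R s) scalar_re_le//.
  apply: le_trans (ler_dual_norm _ _) _.
  by apply: le_trans g_norm; rewrite ler_piMl.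
have -> : \sum_(f <- L) (scalar_re (f x) - scalar_re (x'' f)) ^+ 2 =
    scalar_re (g x) - scalar_re (x'' g).
  rewrite gzE gE -sumrB; apply: eq_bigr => f _.
  by rewrite -mulrBr expr2.
lra.
Qed.

(** The points of the ball close to x'' on a finite set of functionals form a
  filter base. Real parts suffice for the closeness, since the scalar multiples
  of the functionals are tested too. *)
Lemma goldstine (x'' : dual (dual X)) : `|x''| <= 1 ->
  exists F : set_system X, [/\ ProperFilter F, F [set x | `|x| <= 1] &
    forall f : dual X, (f x : K^o) @[x --> F] --> (x'' f : K^o)].
Proof.
move=> x''1.
pose dist (L : seq (dual X)) x : R :=
  \sum_(f <- L) (scalar_re (f x) - scalar_re (x'' f)) ^+ 2.
pose D := [set i : seq (dual X) * R | 0 < i.2].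
pose B (i : seq (dual X) * R) := [set x : X | `|x| <= 1 /\ dist i.1 x <= i.2].
have dist_ge0 L x : 0 <= dist L x.
  by apply: sumr_ge0 => f _; exact: sqr_ge0.
have FB : ProperFilter (filter_from D B).
  apply: filter_from_proper; last first.
    move=> [L e] /= e0.
    by have [x x1 xe] := goldstine_sum_squares L x''1 e0; exists x.
  apply: filter_from_filter; first by exists ([::], 1); exact: ltr01.
  move=> [L1 e1] [L2 e2] /= e10 e20; exists (L1 ++ L2, Num.min e1 e2).
    by rewrite /D /= lt_min e10.
  move=> x [x1]; rewrite /dist big_cat /= le_min => /andP[h1 h2].
  by split; split=> //=; [apply: le_trans h1|apply: le_trans h2];
    rewrite ?lerDl ?lerDr dist_ge0.
exists (filter_from D B); split=> //.
  by exists ([::], 1); [exact: ltr01|move=> x []].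
have re_cvg (f : dual X) :
    scalar_re (f x) @[x --> filter_from D B] --> scalar_re (x'' f).
  apply/cvgrPdist_le => /= e e0; exists ([:: f], e ^+ 2).
    exact: exprn_gt0.
  move=> x [_]; rewrite /dist big_seq1 /= distrC => h.
  by rewrite -(@ler_pXn2r _ 2)// ?nnegrE ?(ltW e0)// real_normK ?num_real.
have [c [d [cdE hcvg]]] := @cvg_scalar_decomposition R s.
move=> f; rewrite [x'' f]cdE; apply: hcvg; first exact: re_cvg.
by have := re_cvg (d *: f); rewrite linearZ.
Qed.

End goldstine.

(** * Gantmacher's theorem *)

Section gantmacher.
Variables (R : realType) (s : scalar_kind).
Local Notation K := (scalar_field R s).
Variables (X Y : normedModType K) (S : X -> Y) (T : dual Y -> dual X).
Local Notation adjointness :=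
  (forall (y' : dual Y) x, T y' x = y' (S x)).
Local Notation ball := [set x : X | `|x| <= 1].

Lemma adjoint_is_linear : adjointness -> linear T.
Proof.
move=> TE a f g; apply/val_inj/funext => x.
rewrite -[LHS]/(T (a *: f + g) x) TE.
by rewrite -[RHS]/(a *: (T f x : K^o) + T g x) !TE.
Qed.

(** A compact set containing the image of the ball suffices: the filter given by
  [goldstine] clusters in it, and evaluations at a point pass to the limit. *)
Lemma compact_adjoint_continuous : adjointness ->
  precompact (S @` ball : set (weak Y)) ->
  continuous (T : weak_star Y -> weak (dual X)).
Proof.
move=> TE [K0 SK0 [cK0 _]].
have repr (x'' : dual (dual X)) : `|x''| <= 1 ->
    exists y, forall y' : dual Y, x'' (T y') = y' y.
  move=> /goldstine[F [FF Fball Fcvg]].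
  have FK0 : F (S @^-1` K0).
    by apply: filterS Fball => x x1; apply: SK0; exists x.
  have [y [_]] := cK0 (S @ F) _ FK0.
  rewrite cluster_cvgE => -[G PG [/weak_cvgP Gy FG]]; exists y => y'.
  have GT : y' @ G --> (x'' (T y') : K^o).
    move=> U /(Fcvg (T y')) TU; apply: (FG (y' @^-1` U)).
    suff : F (S @^-1` (y' @^-1` U)) by [].
    have {}TU : F (T y' @^-1` U) := TU.
    by apply: filterS TU => x; rewrite /= TE.
  exact: (cvg_unique _ GT (Gy y')).
move=> f; have FT : Filter (T @ nbhs (f : weak_star Y)) by exact: fmap_filter.
apply/(@weak_cvgP _ _ (dual X)) => x''.
(* Scaling brings x'' into the unit ball, where repr applies. *)
have [y yE] : exists y, forall y' : dual Y, x'' (T y') = y' y.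
  have a0 : 0 < `|x''| + 1 by rewrite ltr_wpDl.
  have [|y yE] := repr ((`|x''| + 1)^-1 *: x'').
    rewrite normrZ ger0_norm ?invr_ge0 ?(ltW a0)// ler_pdivrMl// mulr1.
    by rewrite lerDl.
  exists ((`|x''| + 1) *: y) => y'; rewrite linearZ /= -yE.
  by rewrite -[RHS]/((`|x''| + 1) * (_ * x'' (T y'))) mulVKf// gt_eqF.
have fy : (y' y : K^o) @[y' --> nbhs (f : weak_star Y)] --> (f y : K^o).
  by move: y {yE}; apply/weak_star_cvgP.
have xT : (fun y' => x'' (T y')) = (fun y' => y' y) by exact/funext.
suff : (x'' (T y') : K^o) @[y' --> nbhs (f : weak_star Y)] -->
    (x'' (T f) : K^o).
  by [].
by rewrite yE xT.
Qed.

Lemma adjoint_continuous_compact : adjointness ->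
  continuous (T : weak_star Y -> weak (dual X)) ->
  precompact (S @` ball : set (weak Y)).
Proof.
move=> TE cT.
have repr (x'' : dual (dual X)) :
    exists y, forall y' : dual Y, x'' (T y') = y' y.
  apply: weak_star_functional.
    by move=> a f g; rewrite (adjoint_is_linear TE) linearP.
  move=> f.
  have FT : Filter (T @ nbhs (f : weak_star Y)) by exact: fmap_filter.
  exact: ((@weak_cvgP R s (dual X) _ (T f) FT).1 (cT f) x'').
(* C is the image of the unit ball of X^** under the second adjoint of S.
   Membership of y in C only involves the values y' y, so a weak limit of points
   of C is in C as soon as some weak limit of them is. *)
pose C : set (weak Y) := [set y | exists2 x'' : dual (dual X), `|x''| <= 1 &
  forall y' : dual Y, x'' (T y') = y' y].
have limC (F : set_system (weak Y)) : UltraFilter F -> F C ->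
    exists2 y : weak Y, C y & F --> y.
  move=> FU FC.
  have /choice[p pE] : forall y, exists x'' : dual (dual X), C y ->
      `|x''| <= 1 /\ forall y' : dual Y, x'' (T y') = y' y.
    move=> y; have [[x'' x''1 x''E]|nCy] := pselect (C y); first by exists x''.
    by exists 0.
  have [|x'' x''1 x''cvg] := @banach_alaoglu R s (dual X) _ F p 1 FU.
    by apply: filterS FC => y /pE[].
  have [y yE] := repr x''; exists y; first by exists x''.
  apply/weak_cvgP => y'; rewrite -yE.
  apply: cvg_trans (x''cvg (T y')); apply: near_eq_cvg.
  by apply: filterS FC => z /pE[_ ->].
exists C.
  move=> _ [x x1 <-]; have [x'' x''1 x''E] := bidual_eval x.
  exists x''; first exact: le_trans x1.
  by move=> y'; rewrite x''E TE.
split.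
  rewrite compact_ultra => F FU FC; have [y Cy Fy] := limC F FU FC.
  by exists y.
move=> y; rewrite closureEcvg => -[G PG [Gy CG]].
have [F [FU GF]] := ultraFilterLemma PG.
have [z [x'' x''1 x''E] Fz] := limC F FU (GF _ (CG C (fun _ => id))).
exists x'' => // y'; rewrite x''E.
have /weak_cvgP/(_ y') Fy : F --> (y : weak Y) by apply: cvg_trans Gy.
move/weak_cvgP/(_ y') : Fz => Fz.
exact: (cvg_unique _ Fz Fy).
Qed.

Theorem gantmacher : adjointness ->
  precompact (S @` ball : set (weak Y)) <->
  continuous (T : weak_star Y -> weak (dual X)).
Proof.
move=> TE; split; first exact: compact_adjoint_continuous.
exact: adjoint_continuous_compact.
Qed.

End gantmacher.

Theorem theorem2p6 (R : realType) (s : scalar_kind)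
  (A : banach_algebra R s) (B : banach_bimodule A)
  (n : nat) (even_n : ~~ odd n) (b0 : iterdual B n.+1) :
  wap_left B even_n b0 <->
  continuous ((fun b'' : iterdual B n.+2 => bidual_act B even_n b'' b0)
    : weak_star (iterdual B n.+1) -> weak (iterdual A n.+1)).
Proof.
(* The adjointness relation is the definition of b'' b0. *)
exact: (@gantmacher R s (iterdual A n) (iterdual B n.+1)
  (dual_act B even_n b0) (fun b'' => bidual_act B even_n b'' b0)).
Qed.
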